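(* Let $\Sigma=\{1<\cdots<m\}$ and $w\in\Sigma^*$. Let $\ell_0=1^{|w|_1}2^{|w|_2}\cdots m^{|w|_m}$. Then the $2$-binomial equivalence class $[w]_{\sim_2}$ is exactly the set of words $v$ that can be reached from $\ell_0$ by a path of length $\sum_{1\le a<b\le m}\binom{w}{ba}$, in the exchange structure described in the context, which has exactly $\binom{w}{ba}$ edges labeled $ab\mapsto ba$ for each pair of letters $a<b$.
   Context: $|w|_a$ is the number of occurrences of the letter $a$ in $w$. For words $u,x$, $\binom{u}{x}$ is the number of times $x$ appears as a (not necessarily contiguous) subsequence of $u$. Two words $u,v\in\Sigma^*$ are $2$-binomially equivalent, $u\sim_2 v$, if $\binom{u}{x}=\binom{v}{x}$ for all words $x$ of length at most $2$; $[w]_{\sim_2}$ is the class of $w$. Exchange structure: nodes are words over $\Sigma$, the root is $\ell_0$, and there is a directed edge from $v$ to $v'$, labeled $ab\mapsto ba$ (with letters $a<b$), if and only if $v'$ is obtained from $v$ by an exchange of two adjacent letters $ab$ into $ba$, i.e. $v=xaby$ and $v'=xbay$ for some words $x,y\in\Sigma^*$. *)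

(* Defs.v *)
From mathcomp Require Import all_boot.

Set Implicit Arguments.
Unset Strict Implicit.
Unset Printing Implicit Defensive.

(* Words over the ordered alphabet {1 < ... < m}: the letter i is represented
   by the ordinal of value i - 1. *)
Definition word (m : nat) := seq 'I_m.

(* The number of occurrences of x in u as a scattered subword: a bit mask of
   length [size u] is the choice of a set of positions of u. *)
Definition wbinom (m : nat) (u x : word m) : nat :=
  #|[set b : (size u).-tuple bool | mask b u == x]|.

Definition binom_equiv (m k : nat) (u v : word m) : Prop :=
  forall x : word m, size x <= k -> wbinom u x = wbinom v x.

(* The word 1^{|w|_1} 2^{|w|_2} ... m^{|w|_m}; [enum 'I_m] is increasing. *)
Definition ell0 (m : nat) (w : word m) : word m :=
  flatten [seq nseq (count_mem a w) a | a <- enum 'I_m].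

(* There is an edge from v to v' whose label (a, b) stands for ab |-> ba. *)
Definition exchange_edge (m : nat) (l : 'I_m * 'I_m) (v v' : word m) : Prop :=
  l.1 < l.2 /\
  exists x y : word m,
    v = x ++ [:: l.1; l.2] ++ y /\ v' = x ++ [:: l.2; l.1] ++ y.

(* [exchange_path v ls v']: there is a directed path from v to v' whose
   successive edges are labeled by ls, so that its length is [size ls]. *)
Inductive exchange_path (m : nat) :
    word m -> seq ('I_m * 'I_m) -> word m -> Prop :=
| exchange_path_nil v : exchange_path v [::] v
| exchange_path_cons l v v' ls v'' :
    exchange_edge l v v' -> exchange_path v' ls v'' ->
    exchange_path v (l :: ls) v''.

(* Main.v *)
Require Import Defs.
From mathcomp Require Import all_boot.
From mathcomp Require Import zify.

Set Implicit Arguments.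
Unset Strict Implicit.
Unset Printing Implicit Defensive.

(** For [a < b], an exchange [ab |-> ba] raises the number of occurrences of
  [ba] by one, and leaves unchanged the Parikh vector and the numbers of
  occurrences of [dc] for all other pairs [c < d].  As [ell0 w] is sorted and so
  contains no [ba], the labels of a path from [ell0 w] to [v] count the
  inversions of [v].  Conversely, insertion sort run backwards is a path from
  [ell0 v] to [v].  Finally, the Parikh vector and the inversion numbers
  determine the 2-binomial class, because
  [binom(u, ab) + binom(u, ba) = |u|_a |u|_b] for [a <> b]. *)

(** * Counting subwords of length at most two *)

Section Subwords.

Variable m : nat.
Implicit Types (a b c d x y : 'I_m) (s t u v w : word m).

Lemma count_mem_cons x c u : count_mem x (c :: u) = (c == x) + count_mem x u.
Proof. by []. Qed.

Lemma wbinomE u t : wbinom u t = \sum_(k : (size u).-tuple bool) (mask k u == t).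
Proof.
rewrite /wbinom -sum1_card big_mkcond /=.
by apply: eq_bigr => k _; rewrite inE; case: (_ == _).
Qed.

(** The first bit of a mask either drops [c], giving the first summand, or keeps it, giving the
    second. *)
Lemma wbinom_cons c u t :
  wbinom (c :: u) t =
    wbinom u t + \sum_(k : (size u).-tuple bool) (c :: mask k u == t).
Proof.
rewrite !wbinomE /=.
pose h (p : bool * (size u).-tuple bool) := cons_tuple p.1 p.2.
rewrite (reindex h) /=; last first.
  exists (fun k : (size u).+1.-tuple bool => (thead k, behead_tuple k)).
    by move=> [b k] _; congr pair; apply: val_inj.
  by move=> k _; case/tupleP: k => b k; apply: val_inj.
rewrite -(pair_bigA _ (fun (b : bool) (k : (size u).-tuple bool) =>
  (mask (h (b, k)) (c :: u) == t) : nat)) /=.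
by rewrite big_bool /= addnC.
Qed.

Lemma wbinom_nil_cons x t : wbinom [::] (x :: t) = 0.
Proof. by rewrite wbinomE big1 // => k _; rewrite mask0. Qed.

Lemma wbinom_cons_cons c u x t :
  wbinom (c :: u) (x :: t) = wbinom u (x :: t) + (c == x) * wbinom u t.
Proof.
rewrite wbinom_cons; congr addn; rewrite wbinomE big_distrr /=.
by apply: eq_bigr => k _; rewrite eqseq_cons mulnb.
Qed.

Lemma wbinom0 u : wbinom u [::] = 1.
Proof.
elim: u => [|c u IHu].
  rewrite wbinomE (eq_bigr (fun=> 1)) => [|k _]; last by rewrite mask0.
  by rewrite sum1_card card_tuple expn0.
by rewrite wbinom_cons IHu big1.
Qed.

Lemma wbinom1 u x : wbinom u [:: x] = count_mem x u.
Proof.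
elim: u => [|c u IHu]; first exact: wbinom_nil_cons.
by rewrite wbinom_cons_cons IHu wbinom0 muln1 addnC.
Qed.

Lemma wbinom2_cons c u x y :
  wbinom (c :: u) [:: x; y] = wbinom u [:: x; y] + (c == x) * count_mem y u.
Proof. by rewrite wbinom_cons_cons wbinom1. Qed.

Lemma wbinom2_cat s t x y :
  wbinom (s ++ t) [:: x; y] =
    wbinom s [:: x; y] + count_mem x s * count_mem y t + wbinom t [:: x; y].
Proof.
elim: s => [|c s IHs]; first by rewrite wbinom_nil_cons.
by rewrite cat_cons !wbinom2_cons IHs count_cat count_mem_cons; lia.
Qed.

(** A position of [x] and a position of [y] come in one order or the other, or coincide, which
    happens only if [x = y]. *)
Lemma wbinom2_sym u x y :
  wbinom u [:: x; y] + wbinom u [:: y; x] + (x == y) * count_mem x u =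
    count_mem x u * count_mem y u.
Proof.
elim: u => [|c u]; first by rewrite !wbinom_nil_cons muln0.
rewrite !wbinom2_cons !count_mem_cons.
by case: (c =P x) => [->|cx]; case: eqP => [<-|xy]; rewrite ?eqxx /=; lia.
Qed.

Lemma binom_equiv2P w v :
  binom_equiv 2 w v <->
    perm_eq w v /\
    forall a b, a < b -> wbinom w [:: b; a] = wbinom v [:: b; a].
Proof.
split=> [wv|[/permP wv inv_wv]].
  split=> [|a b _]; last exact: wv.
  by apply/allP => x _ /=; rewrite -!wbinom1 wv.
case=> [|x [|y [|//]]] _; rewrite ?wbinom0 ?wbinom1 ?wv //.
have := wbinom2_sym w x y; have := wbinom2_sym v x y; rewrite !wv.
have := inv_wv x y; have := inv_wv y x.
(* If [y < x], the hypothesis applies directly; if [x < y], it gives the count of [yx], hence that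
   of [xy]; if [x = y], the identity determines twice the count. *)
case: (ltngtP x y) => [xy _ /(_ isT)|yx /(_ isT) //|/val_inj->].
- by lia.
- by rewrite eqxx; lia.
Qed.

End Subwords.

(** * Invariants along exchange paths *)

Section ExchangePaths.

Variable m : nat.
Implicit Types (a b c d : 'I_m) (l : 'I_m * 'I_m) (ls : seq ('I_m * 'I_m)).
Implicit Types (s t u v w : word m).

Lemma exchange_edge_perm l v v' : exchange_edge l v v' -> perm_eq v v'.
Proof.
case=> _ [s [t [-> ->]]].
by rewrite perm_cat2l perm_cat2r (perm_catC [:: l.1] [:: l.2]).
Qed.

(** Only the exchanged factor contributes differently to the two counts: [ab] never contains [dc],
    and [ba] does exactly when [(a, b) = (c, d)]. *)
Lemma exchange_edge_wbinom l v v' c d :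
  exchange_edge l v v' -> c < d ->
  wbinom v' [:: d; c] = wbinom v [:: d; c] + (l == (c, d)).
Proof.
case: l => a b [/= ltab [s [t [-> ->]]]] ltcd.
rewrite !wbinom2_cat !wbinom2_cons !count_mem_cons xpair_eqE -!val_eqE /=.
by do 4!case: eqP => ? /=; lia.
Qed.

Lemma exchange_path_perm v ls v' : exchange_path v ls v' -> perm_eq v v'.
Proof.
elim=> // l u u' ls' u'' /exchange_edge_perm + _.
exact: perm_trans.
Qed.

Lemma exchange_path_wbinom v ls v' c d :
  exchange_path v ls v' -> c < d ->
  wbinom v' [:: d; c] = wbinom v [:: d; c] + count_mem (c, d) ls.
Proof.
move=> vv' ltcd; elim: vv' => [u|l u u' ls' u'' uu' _ ->]; first by rewrite addn0.
by rewrite (exchange_edge_wbinom uu' ltcd) addnA.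
Qed.

Lemma exchange_path_label v ls v' :
  exchange_path v ls v' -> all (fun l => l.1 < l.2) ls.
Proof. by elim=> //= l u u' ls' u'' [-> _]. Qed.

Lemma exchange_path_rcons v ls v' l v'' :
  exchange_path v ls v' -> exchange_edge l v' v'' ->
  exchange_path v (rcons ls l) v''.
Proof.
elim=> [u|l' u u' ls' u'' uu' _ IH] /= e; last exact: exchange_path_cons (IH e).
exact: exchange_path_cons (exchange_path_nil _).
Qed.

Lemma exchange_path_cat v ls v' ls' v'' :
  exchange_path v ls v' -> exchange_path v' ls' v'' ->
  exchange_path v (ls ++ ls') v''.
Proof.
by elim=> [|l u u' ls1 u'' uu' _ IH] //= /IH; apply: exchange_path_cons.
Qed.

Lemma exchange_path_consr c v ls v' :
  exchange_path v ls v' -> exchange_path (c :: v) ls (c :: v').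
Proof.
elim=> [u|l u u' ls' u'' [ltl [s [t [-> ->]]]] _]; first exact: exchange_path_nil.
by apply: exchange_path_cons; split=> //; exists (c :: s), t.
Qed.

(** * Sorted words and paths from them *)

Let leo : rel 'I_m := relpre val leq.

Let leo_trans : transitive leo.
Proof. by move=> b a c; apply: leq_trans. Qed.

Lemma exchange_path_insert c s : sorted leo s ->
  exists t ls, [/\ sorted leo t, perm_eq t (c :: s) & exchange_path t ls (c :: s)].
Proof.
elim: s => [|d s IHs] s_sorted.
  by exists [:: c], [::]; split=> //; apply: exchange_path_nil.
have [lecd|ltdc] := leqP c d.
  exists [:: c, d & s], [::]; split=> //; last exact: exchange_path_nil.
  by rewrite /= [leo c d]lecd.
(* Here [d < c]: the path for [c :: s], carried out behind [d], ends in [d :: c :: s], and a last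
   exchange of [d] and [c] gives [c :: d :: s]. *)
have [t [ls [t_sorted tE tp]]] := IHs (path_sorted s_sorted).
exists (d :: t), (rcons ls (d, c)); split.
- rewrite /= path_sortedE // t_sorted (perm_all _ tE) /= [leo d c]ltnW //=.
  by rewrite (order_path_min leo_trans s_sorted).
- rewrite -(perm_cons d) in tE; apply: perm_trans tE _.
  by apply/permP => p /=; lia.
- apply: exchange_path_rcons (exchange_path_consr d tp) _.
  by split=> //; exists [::], s.
Qed.

Lemma exchange_path_sorted v :
  exists s ls, [/\ sorted leo s, perm_eq s v & exchange_path s ls v].
Proof.
elim: v => [|c v [s [ls [s_sorted sE sp]]]].
  by exists [::], [::]; split=> //; apply: exchange_path_nil.
have [t [ls' [t_sorted tE tp]]] := exchange_path_insert c s_sorted.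
exists t, (ls' ++ ls); split=> //.
  by rewrite (perm_trans tE) // perm_cons.
exact: exchange_path_cat tp (exchange_path_consr c sp).
Qed.

Lemma sorted_wbinom0 s a b : sorted leo s -> a < b -> wbinom s [:: b; a] = 0.
Proof.
move=> + ltab; elim: s => [|c s IHs] s_sorted; first exact: wbinom_nil_cons.
rewrite wbinom2_cons IHs ?(path_sorted s_sorted) //.
case: eqP => // cb; rewrite mul1n; apply/count_memPn/negP => /=.
move/(allP (order_path_min leo_trans s_sorted)).
by rewrite cb /leo /= leqNgt ltab.
Qed.

Lemma ell0_sorted w : sorted leo (ell0 w).
Proof.
rewrite /ell0; have : sorted (relpre val ltn) (enum 'I_m).
  by rewrite -sorted_map val_enum_ord iota_ltn_sorted.
elim: (enum 'I_m) => [//|a e IHe] /= ae.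
(* The later blocks only contain letters above [a], so the block of [a] can be put in front, one
   letter at a time. *)
have a_min : all (leo a) (flatten [seq nseq (count_mem c w) c | c <- e]).
  apply/allP => c /flatten_mapP [d de /nseqP [-> _]].
  have tr : transitive (relpre val ltn : rel 'I_m).
    by move=> ? ? ?; apply: ltn_trans.
  exact/ltnW/(allP (order_path_min tr ae)).
elim: (count_mem a w) => [|n IHn] /=; first exact/IHe/(path_sorted ae).
rewrite path_sortedE // IHn all_cat a_min !andbT.
by apply/allP => c /nseqP [-> _]; apply: leqnn.
Qed.

Lemma ell0_perm w : perm_eq (ell0 w) w.
Proof.
apply/allP => c _ /=; apply/eqP.
rewrite /ell0 count_flatten -map_comp sumnE big_map big_enum /=.
rewrite (bigD1 c) //= count_nseq /= eqxx mul1n big1 ?addn0 // => a ac.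
by rewrite count_nseq /= (negbTE ac).
Qed.

Lemma exchange_path_from_ell0 v : exists ls, exchange_path (ell0 v) ls v.
Proof.
have [s [ls [s_sorted sE sp]]] := exchange_path_sorted v.
(* Two sorted words with the same letters are equal. *)
exists ls; suff -> : ell0 v = s by [].
apply: (sorted_eq leo_trans) => //; last 1 first.
- by apply: perm_trans (ell0_perm v) _; rewrite perm_sym.
- by move=> a b /anti_leq /val_inj.
- exact: ell0_sorted.
Qed.

Lemma ell0_eq_perm w v : perm_eq w v -> ell0 w = ell0 v.
Proof.
by move=> /permP wv; congr flatten; apply: eq_map => a; rewrite wv.
Qed.

Lemma exchange_path_ell0_count w ls v a b :
  exchange_path (ell0 w) ls v -> a < b ->
  count_mem (a, b) ls = wbinom v [:: b; a].
Proof.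
move=> p ltab.
by rewrite (exchange_path_wbinom p ltab) (sorted_wbinom0 (ell0_sorted w)).
Qed.

(** Every label is a pair [(a, b)] with [a < b], so the double sum counts each edge exactly once. *)
Lemma exchange_path_size v ls v' :
  exchange_path v ls v' ->
  size ls = \sum_(a < m) \sum_(b < m | a < b) count_mem (a, b) ls.
Proof.
move/exchange_path_label; elim: ls => [|[c d] ls IHls] /=.
  by move=> _; rewrite big1 // => a _; rewrite big1.
case/andP=> ltcd /IHls ->.
under [in RHS]eq_bigr do rewrite big_split /=.
rewrite big_split /= -[LHS]add1n; congr addn.
rewrite pair_big_dep /= (bigD1 (c, d)) //= eqxx big1 // => -[a b] /= /andP[_].
by rewrite eq_sym => /negbTE ->.
Qed.

End ExchangePaths.

Theorem mainTheorem3 (m : nat) (w v : word m) :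
  binom_equiv 2 w v <->
  exists ls : seq ('I_m * 'I_m),
    [/\ exchange_path (ell0 w) ls v,
        size ls = \sum_(a < m) \sum_(b < m | a < b) wbinom w [:: b; a]
      & forall a b : 'I_m, a < b ->
          count_mem (a, b) ls = wbinom w [:: b; a]].
Proof.
rewrite binom_equiv2P; split=> [[wv inv_wv]|[ls [p _ ls_count]]].
  (* Equivalent words have the same sorted word, so the path to [v] starts at [ell0 w]. *)
  have [ls] := exchange_path_from_ell0 v; rewrite -(ell0_eq_perm wv) => p.
  have ls_count (a b : 'I_m) (ltab : a < b) :
      count_mem (a, b) ls = wbinom w [:: b; a].
    by rewrite (exchange_path_ell0_count p ltab) inv_wv.
  exists ls; split=> //; rewrite (exchange_path_size p).
  by apply: eq_bigr => a _; apply: eq_bigr => b /ls_count.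
(* The label counts equal the inversion numbers of [v] because of the path, and those of [w] by
   assumption. *)
split=> [|a b ltab]; last by rewrite -ls_count // (exchange_path_ell0_count p).
by apply: perm_trans (exchange_path_perm p); rewrite perm_sym ell0_perm.
Qed.
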